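(* Let $m\ge 1$, $q\ge 1$ and $n_1,\dots,n_q\ge 0$ be integers, and let $A_{i,j}$, $i=1,\dots,q$, $j=1,\dots,n_i+1$, be points in $\mathbb{R}^m$ such that the set of all their coordinates is algebraically independent (the $m\sum_{i}(n_i+1)$ coordinates being pairwise distinct). Suppose $0\le t\le d\le T\le m$ are integers and $\Pi^d$ is a $d$-plane in $\mathbb{R}^m$ parallel to some coordinate planes $\Pi^t\subset\Pi^T\subset\mathbb{R}^m$. If either (a) $d-t+1\le q$ and $n_1+n_2+\dots+n_q+1\le (m-d)(q-1)-(T-d)(d-t)$, or (b) $q\le d-t+1$ and $n_1+n_2+\dots+n_q+1\le (m-T)(q-1)$, then there exists $i\in\{1,2,\dots,q\}$ such that $\Pi^d$ does not meet the linear hull (i.e. affine span) $\Pi(M_i)$ of the set $M_i=\{A_{i,1},\dots,A_{i,n_i+1}\}$.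
   Context: A $k$-plane $\Pi^k\subset\mathbb{R}^m$ is a $k$-dimensional affine (not necessarily coordinate) plane. A coordinate $k$-plane is the linear span of $k$ of the standard unit coordinate vectors of $\mathbb{R}^m$; for coordinate planes, $\Pi^t\subset\Pi^T$ means $\Pi^t$ is a linear subspace of $\Pi^T$. For $t\le d\le T$, a $d$-plane $\Pi^d$ is parallel to coordinate planes $\Pi^t\subset\Pi^T$ if its direction space $V$ (the linear subspace of which $\Pi^d$ is a translate) satisfies $\Pi^t\subset V\subset\Pi^T$. A real number $v$ is algebraically dependent on real numbers $u_1,\dots,u_k$ if $v$ satisfies an equation $p_0(u)+p_1(u)v+\dots+p_s(u)v^s=0$, where $p_0(u),\dots,p_s(u)$ are values of polynomials in $u_1,\dots,u_k$ with rational coefficients, not all of these values being $0$. A finite set of real numbers is algebraically independent if none of them depends algebraically on the others. *)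

(* Defs.v *)
From mathcomp Require Import all_boot all_order all_algebra.
From mathcomp Require Import boolp classical_sets reals.
From mathcomp Require Import mpoly.

Set Implicit Arguments.
Unset Strict Implicit.
Unset Printing Implicit Defensive.

Import Order.TTheory GRing.Theory Num.Theory.

Local Open Scope ring_scope.
Local Open Scope classical_set_scope.

Section AlgebraicIndependence.
Variable R : realType.
Implicit Types (v : R) (u S : seq R).

Definition ratpoly_eval u (p : {mpoly rat[size u]}) : R :=
  (map_mpoly (ratr : rat -> R) p).@[tnth (in_tuple u)].

Definition alg_dependent v u : Prop :=
  exists (s : nat) (p : 'I_s.+1 -> {mpoly rat[size u]}),
    (exists k, ratpoly_eval (p k) != 0) /\
    \sum_(k < s.+1) ratpoly_eval (p k) * v ^+ k = 0.

(* S stands for the finite set of its entries: repetitions are irrelevant. *)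
Definition alg_independent S : Prop :=
  forall v, v \in S -> ~ alg_dependent v [seq u <- S | u != v].

End AlgebraicIndependence.

Section Planes.
Variables (R : realType) (m : nat).
Implicit Types (P : set 'rV[R]_m) (U V W : {vspace 'rV[R]_m}).

Definition is_translate P V : Prop :=
  exists p : 'rV[R]_m, P = [set x | x - p \in V].

Definition is_plane (k : nat) P : Prop :=
  exists V, \dim V = k /\ is_translate P V.

Definition is_coord_plane (k : nat) U : Prop :=
  exists I : {set 'I_m},
    #|I| = k /\ U = span [seq delta_mx ord0 i : 'rV[R]_m | i <- enum I].

(* The direction space V is determined by P, so the existential only names
   it. *)
Definition parallel_to P U W : Prop :=
  exists V, is_translate P V /\ (U <= V <= W)%VS.

Definition affine_span (k : nat) (M : 'I_k -> 'rV[R]_m) : set 'rV[R]_m :=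
  [set x | exists c : 'I_k -> R,
     \sum_(j < k) c j = 1 /\ x = \sum_(j < k) c j *: M j].

(* One entry for each triple (i, j, c), so that uniq (coordinates A) says that
   the m * \sum_i (n i).+1 coordinates are pairwise distinct. *)
Definition coordinates (q : nat) (n : 'I_q -> nat)
    (A : forall i : 'I_q, 'I_(n i).+1 -> 'rV[R]_m) : seq R :=
  [seq A (tag x) (tagged x).1 0 (tagged x).2
     | x : {i : 'I_q & ('I_(n i).+1 * 'I_m)%type}].

End Planes.

(* Main.v *)
From HB Require Import structures.
Require Import Defs.
From mathcomp Require Import all_boot all_order all_algebra.
From mathcomp Require Import boolp classical_sets reals.
From mathcomp Require Import mpoly.
From mathcomp Require Import zify ring.

Set Implicit Arguments.
Unset Strict Implicit.
Unset Printing Implicit Defensive.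

Import Order.TTheory GRing.Theory Num.Theory.

Local Open Scope ring_scope.
Local Open Scope classical_set_scope.

(** The proof counts transcendence degrees.  Suppose that the plane [Pd], with
direction space [V], meets the affine span of each [A i] in a point
[x i = \sum_j c i j *: A i j], where [\sum_j c i j = 1].  For each [i] choose a
pivot [p] with [c i p != 0].  The point [A i p] is then a rational function of
[x i], of the other points of [A i] and of the other coefficients [c i j].  So
all [m * \sum_i (n i + 1)] coordinates of the points [A i j] lie in the field
generated over the rationals by

- the coordinates of the non-pivot points, [m * \sum_i n i] numbers,
- the non-pivot coefficients, [\sum_i n i] numbers,
- the coordinates of the points [x i].

The [q] points [x i] are far from arbitrary.  The first one costs [m] numbers.
The [q - 1] differences [x i - x 0] lie in [V], hence vanish outside the [T]
directions of [PT]; on the [t] directions of [Pt] they cost [(q - 1) * t]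
numbers; on the remaining [T - t] directions they form a matrix whose rows lie
in the image of [V] under a projection that kills [Pt], so that its rank [r] is
at most [d - t].  Matrices of rank [r] depend on only
[r * ((q - 1) + (T - t) - r)] numbers: [r] independent rows, and the
coefficients that express the other rows through them
([rank_factorization_generators], [rank_projection_le]).

Each numerical hypothesis says exactly that these generators are fewer than the
coordinates at the largest possible rank ([parameter_count]), which is [d - t]
in case (a) and [q - 1] in case (b).  But [N] elements of a field generated by [M < N]
elements satisfy a nonzero polynomial relation ([algebraic_relation]), while
algebraically independent numbers satisfy none ([alg_independent_relation]).

The relation between [N] elements comes from linear algebra and needs no
transcendence bases.  Write them as [y_i = f_i(z) / g_i(z)].  After
multiplication by the [k]-th power of the product of the [g_i], the [k ^ N]
monomials in the [y_i] of
partial degrees below [k] become polynomials in [z] of degree [O(k)], which live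
in a space of dimension [O(k ^ M)].  For large [k] they are linearly
dependent. *)

(** * Polynomial relations between rational functions *)

Section RationalFunctions.
Variables (F L : fieldType) (iota : {rmorphism F -> L}).

(** The subfield [F(z)] of [L]; the denominator is nonzero at [z], not just as a
polynomial, because the entries of [z] may be algebraically dependent. *)
Definition ratfun_values (M : nat) (z : 'I_M -> L) : {pred L} :=
  fun x => `[< exists f g : {mpoly F[M]},
                 mmap iota z g != 0 /\ x * mmap iota z g = mmap iota z f >].

Lemma ratfun_valuesP M (z : 'I_M -> L) x :
  reflect (exists f g : {mpoly F[M]},
             mmap iota z g != 0 /\ x * mmap iota z g = mmap iota z f)
          (x \in ratfun_values z).
Proof. exact: asboolP. Qed.

Lemma ratfun_values_gen M (z : 'I_M -> L) i : z i \in ratfun_values z.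
Proof.
apply/ratfun_valuesP; exists 'X_i, 1.
by rewrite mmapX mmap1U rmorph1 oner_neq0 mulr1.
Qed.

Fact ratfun_values_divring_closed M (z : 'I_M -> L) :
  divring_closed (ratfun_values z).
Proof.
split.
- apply/ratfun_valuesP; exists 1, 1.
  by rewrite rmorph1 oner_neq0 mulr1.
- move=> x y /ratfun_valuesP[f [g [g0 xE]]] /ratfun_valuesP[h [k [k0 yE]]].
  apply/ratfun_valuesP; exists (f * k - h * g), (g * k).
  rewrite rmorphB !rmorphM /= -xE -yE mulf_neq0 //; split=> //; ring.
- move=> x y /ratfun_valuesP[f [g [g0 xE]]] /ratfun_valuesP[h [k [k0 yE]]].
  apply/ratfun_valuesP; have [->|y0] := eqVneq y 0.
    by exists 0, 1; rewrite rmorph1 rmorph0 oner_neq0 mulr1 invr0 mulr0.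
  exists (f * k), (g * h); rewrite !rmorphM /= -yE -xE !mulf_neq0 //.
  by split=> //; field.
Qed.

HB.instance Definition _ M (z : 'I_M -> L) :=
  GRing.isDivringClosed.Build L (ratfun_values z)
    (ratfun_values_divring_closed z).

Lemma card_bounded_monomials M B : (#|{: 'X_{1..M < B}}| <= B ^ M)%N.
Proof.
have -> : (B ^ M = #|{ffun 'I_M -> 'I_B}|)%N by rewrite card_ffun !card_ord.
have lt_B (m : 'X_{1..M < B}) i : ((m : 'X_{1..M}) i < B)%N.
  by apply: leq_ltn_trans (bmdeg m); rewrite mdegE (bigD1 i) //= leq_addr.
pose h (m : 'X_{1..M < B}) := [ffun i => Ordinal (lt_B m i)].
apply: (@leq_card _ _ h) => m1 m2 /ffunP eq_h.
apply/val_inj/mnmP => i /=.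
by have := eq_h i; rewrite !ffunE => /(congr1 val).
Qed.

Lemma msize_mul_le M (p r : {mpoly F[M]}) a b :
  (msize p <= a.+1)%N -> (msize r <= b.+1)%N ->
  (msize (p * r)%R <= (a + b).+1)%N.
Proof.
have [->|p0] := eqVneq p 0; first by rewrite mul0r msize0.
have [->|r0] := eqVneq r 0; first by rewrite mulr0 msize0.
rewrite msizeM // => le_p le_r; move: (leq_add le_p le_r); rewrite addnS addSn.
by case: (_ + _)%N.
Qed.

Lemma msize_exp_le M (p : {mpoly F[M]}) a k :
  (msize p <= a.+1)%N -> (msize (p ^+ k)%R <= (k * a).+1)%N.
Proof.
move=> le_p; elim: k => [|k IHk]; first by rewrite expr0 msize1.
by rewrite exprS mulSn; apply: msize_mul_le.
Qed.

Lemma msize_prod_le M N (p : 'I_N -> {mpoly F[M]}) a :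
  (forall i, msize (p i) <= a.+1)%N ->
  (msize (\prod_i p i)%R <= (N * a).+1)%N.
Proof.
move=> le_p; rewrite -[X in (X * _)%N](card_ord N) -sum_nat_const.
elim/big_rec2: _ => [|i y1 y2 _ le_y]; first by rewrite msize1.
exact: msize_mul_le.
Qed.

(** The counting argument: a nonzero row vector in the kernel of the coefficient
matrix of the polynomials [P a] below is a relation between the monomials of
[y]. *)
Lemma algebraic_relation M N (z : 'I_M -> L) (y : 'I_N -> L) :
    (M < N)%N -> (forall i, y i \in ratfun_values z) ->
  exists2 Q : {mpoly F[N]}, Q != 0 & mmap iota y Q = 0.
Proof.
move=> ltMN yz; have /choice[f] i := ratfun_valuesP _ _ (yz i).
move=> /choice[g fgP].
have g0 i : mmap iota z (g i) != 0 by case: (fgP i).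
have fE i : mmap iota z (f i) = y i * mmap iota z (g i) by case: (fgP i).
pose D := (\sum_i (msize (f i) + msize (g i)))%N.
have fD i : (msize (f i) <= D.+1)%N by rewrite /D (bigD1 i) //=; lia.
have gD i : (msize (g i) <= D.+1)%N by rewrite /D (bigD1 i) //=; lia.
(* This [k] makes [(k * (N * D).+1) ^ M < k ^ N]: the excess factor [k] on the
   right beats the constant [(N * D).+1 ^ M]. *)
pose k := ((N * D).+1 ^ M).+1.
(* [P a] is the monomial of [y] with exponents [a], cleared of denominators by a
   factor that is the same for all [a]. *)
pose P (a : {ffun 'I_N -> 'I_k}) := \prod_i (f i ^+ a i * g i ^+ (k - a i)).
pose B := (N * (k * D)).+1.
have ltPB a : (msize (P a) <= B)%N.
  apply: msize_prod_le => i.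
  have -> : (k * D = a i * D + (k - a i) * D)%N.
    by rewrite -mulnDl subnKC // ltnW.
  by apply: msize_mul_le; apply: msize_exp_le.
pose Mx := \matrix_(a < #|{ffun 'I_N -> 'I_k}|, b < #|{: 'X_{1..M < B}}|)
             (P (enum_val a))@_(enum_val b : 'X_{1..M < B}).
have ltBk : (#|{: 'X_{1..M < B}}| < #|{ffun 'I_N -> 'I_k}|)%N.
  apply: leq_ltn_trans (card_bounded_monomials _ _) _.
  rewrite card_ffun !card_ord.
  have leB : (B <= k * (N * D).+1)%N by rewrite /B mulnS mulnCA; lia.
  apply: (@leq_ltn_trans ((k * (N * D).+1) ^ M)).
    by case: (M) => // M'; rewrite leq_exp2r.
  rewrite expnMn.
  apply: (@leq_trans (k ^ M.+1)); last by rewrite leq_pexp2l.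
  by rewrite expnSr ltn_pmul2l ?expn_gt0.
have /rowV0Pn[v /sub_kermxP vMx v0] : kermx Mx != 0.
  rewrite kermx_eq0 -row_leq_rank -ltnNge.
  exact: leq_ltn_trans (rank_leq_col _) ltBk.
pose mon (a : {ffun 'I_N -> 'I_k}) : 'X_{1..N} := [multinom (a i : nat) | i < N].
have mon_inj : injective mon.
  move=> a b /mnmP eq_ab; apply/ffunP => i; apply/val_inj.
  by have := eq_ab i; rewrite !mnmE.
exists (\sum_a v 0 (enum_rank a) *: 'X_[mon a]).
  have /rV0Pn[j vj] := v0.
  apply: contra_neq vj => /(congr1 (mcoeff (mon (enum_val j)))).
  rewrite raddf_sum mcoeff0 (bigD1 (enum_val j)) //= big1 => [|a ne_a].
    by rewrite mcoeffZ mcoeffX eqxx enum_valK addr0 mulr1.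
  by rewrite mcoeffZ mcoeffX (inj_eq mon_inj) (negbTE ne_a) mulr0.
have relP : \sum_a v 0 (enum_rank a) *: P a = 0.
  apply/mpolyP => b; rewrite mcoeff0 raddf_sum /=.
  have [ltbB|leBb] := ltnP (mdeg b) B; last first.
    rewrite big1 // => a _; rewrite mcoeffZ memN_msupp_eq0 ?mulr0 //.
    by apply: msize_mdeg_ge; apply: leq_trans leBb.
  move/rowP/(_ (enum_rank (BMultinom ltbB))): vMx; rewrite !mxE => vMx.
  rewrite (reindex (fun j : 'I_#|{ffun 'I_N -> 'I_k}| => enum_val j)) /=; last first.
    exact/onW_bij/enum_val_bij.
  rewrite -[RHS]vMx; apply: eq_bigr => a _.
  by rewrite mcoeffZ !mxE enum_rankK enum_valK.
have yP a : mmap iota z (P a) =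
    mmap iota y 'X_[mon a] * \prod_i mmap iota z (g i) ^+ k.
  rewrite mmapX rmorph_prod -big_split; apply: eq_bigr => i _ /=.
  rewrite rmorphM !rmorphXn /= fE exprMn -mulrA -exprD mnmE subnKC //.
  exact: ltnW.
have G0 : \prod_i mmap iota z (g i) ^+ k != 0.
  by apply/prodf_neq0 => i _; rewrite expf_neq0.
apply: (mulIf G0); rewrite mul0r -[RHS](rmorph0 (mmap iota z)) -[in RHS]relP.
rewrite !raddf_sum mulr_suml; apply: eq_bigr => a _.
by rewrite /= !mmapZ yP mulrA.
Qed.
End RationalFunctions.

(** * Algebraically independent numbers satisfy no relation *)

Lemma ratpoly_evalE (R : realType) (u : seq R) (p : {mpoly rat[size u]}) :
  ratpoly_eval p = mmap ratr (tnth (in_tuple u)) p.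
Proof.
rewrite /ratpoly_eval [p in LHS]mpolyE (raddf_sum (map_mpoly ratr)) raddf_sum /=.
apply: eq_bigr => m _ /=.
by rewrite map_mpolyZ map_mpolyX mevalZ mevalX.
Qed.

Section NoRelation.
Variables (R : realType) (N : nat) (y : 'I_N -> R).

(** The coefficient of the [k]-th power of the variable [i] in [p], seen as a
polynomial in that variable; it keeps the [N] variables of [p]. *)
Definition slice (p : {mpoly rat[N]}) (i : 'I_N) (k : nat) : {mpoly rat[N]} :=
  \sum_(m <- msupp p | m i == k) p@_m *: 'X_[m - U_(i) *+ k].

Lemma mmap_slice p i k :
  mmap ratr y (slice p i k) =
  \sum_(m <- msupp p | m i == k) ratr p@_m * \prod_(j | j != i) y j ^+ m j.
Proof.
rewrite raddf_sum; apply: eq_bigr => m /eqP mi.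
rewrite /= mmapZ mmapX /mmap1 (bigD1 i) //=.
rewrite mnmBE mulmnE mnm1E eqxx mul1n mi subnn expr0 mul1r.
congr (_ * _); apply: eq_bigr => j ne_ji.
by rewrite mnmBE mulmnE mnm1E eq_sym (negbTE ne_ji) subn0.
Qed.

Lemma mmap_slices p i :
  mmap ratr y p = \sum_(k < (msize p).+1) mmap ratr y (slice p i k) * y i ^+ k.
Proof.
under eq_bigr => k _ do rewrite mmap_slice mulr_suml.
rewrite (exchange_big_dep predT) //=.
apply: eq_big_seq => m mp.
have le_m : (m i < (msize p).+1)%N.
  have := msize_mdeg_lt mp; rewrite mdegE (bigD1 i) //=; lia.
rewrite (big_pred1 (Ordinal le_m)) => [|k]; last first.
  by rewrite /= eq_sym -val_eqE.
by rewrite /mmap1 (bigD1 i) //= -[RHS]mulrA; congr (_ * _); apply: mulrC.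
Qed.

Lemma msize_slice p i k :
  (0 < k)%N -> p != 0 -> (msize (slice p i k) < msize p)%N.
Proof.
move=> k0 p0; rewrite msizeE.
have sz0 : (0 < msize p)%N by rewrite lt0n msize_poly_eq0.
rewrite -(prednK sz0) ltnS; apply/bigmax_leqP_seq => m + _.
move=> /msupp_sum_le /flattenP[s /mapP[m' ]].
rewrite mem_filter => /andP[/eqP m'i m'p] -> /msuppZ_le.
rewrite msuppX inE => /eqP ->.
have := msize_mdeg_lt m'p; have U : (U_(i) *+ k <= m')%MM.
  apply/mnm_lepP => j; rewrite mulmnE mnm1E.
  by case: eqP => [<-|_]; rewrite ?mul1n ?m'i.
by rewrite -{1}(submK U) mdegD mdegMn mdeg1; lia.
Qed.

(** Monomials of [p] with the same exponent of [i] stay distinct when that power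
is removed, so nothing cancels. *)
Lemma slice_neq0 p i m : m \in msupp p -> slice p i (m i) != 0.
Proof.
move=> mp; have := mp; rewrite mcoeff_msupp; apply: contra_neq.
move=> /(congr1 (mcoeff (m - U_(i) *+ m i))).
rewrite mcoeff0 raddf_sum /= => s0; rewrite -[RHS]s0.
rewrite big_mkcond (bigD1_seq m) ?msupp_uniq //= eqxx big1 => [|m' ne].
  by rewrite mcoeffZ mcoeffX eqxx mulr1 addr0.
case: ifP => // /eqP m'i.
rewrite mcoeffZ mcoeffX; case: eqP => [eq_m|_]; last by rewrite mulr0.
case/eqP: ne; apply/mnmP => j; move/mnmP/(_ j): eq_m.
rewrite !mnmBE !mulmnE mnm1E; case: eqP => [<-|_]; last by rewrite !subn0.
by rewrite m'i.
Qed.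
End NoRelation.

(** Algebraic dependence asks for a polynomial in one of the numbers whose
coefficients do not all vanish as values at the others.  In a nonzero relation
of least degree, take a variable [i] that occurs: the coefficient of a positive
power of it is a nonzero polynomial of smaller degree, so its value is not zero,
and the relation makes [y i] depend on the other entries. *)
Lemma alg_independent_relation (R : realType) (S : seq R) :
    uniq S -> alg_independent S ->
  forall p : {mpoly rat[size S]},
    mmap ratr (tnth (in_tuple S)) p = 0 -> p = 0.
Proof.
move=> uS indS p; set y := tnth (in_tuple S).
have [k] := ubnP (msize p); elim: k => // k IHk in p * => /ltnSE le_pk yp0.
apply: contrapT => /eqP p0.
have slice0 i j : mmap ratr y (slice p i j) = 0.
  apply: contrapT => /eqP sj0; apply: (indS (y i)); first exact: mem_tnth.
  set u := [seq _ <- _ | _].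
  (* [h j'] is the variable that stands for [y j'] among the entries other than
     [y i]; as [S] has no repetition, only [y i] itself is missing there. *)
  have /choice[h hE] : forall j', exists h : {mpoly rat[size u]},
      j' != i -> ratpoly_eval h = y j'.
    move=> j'; have [->|ne] := eqVneq j' i; first by exists 0.
    have yu : y j' \in u.
      rewrite mem_filter mem_tnth andbT /y !(tnth_nth 0) nth_uniq //.
    have /tnthP[l yl] : y j' \in in_tuple u by [].
    exists 'X_l => _; rewrite ratpoly_evalE mmapX mmap1U yl //.
  pose c l := \sum_(m <- msupp p | m i == l)
                p@_m *: \prod_(j' | j' != i) h j' ^+ m j'.
  have cE l : ratpoly_eval (c l) = mmap ratr y (slice p i l).
    rewrite mmap_slice ratpoly_evalE raddf_sum; apply: eq_bigr => m _ /=.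
    rewrite mmapZ rmorph_prod; congr (_ * _); apply: eq_bigr => j' ne.
    by rewrite rmorphXn /= -ratpoly_evalE hE.
  exists (msize p), (fun l : 'I_(msize p).+1 => c l); split; last first.
    by rewrite -[RHS]yp0 (mmap_slices _ _ i); apply: eq_bigr => l _; rewrite cE.
  (* Slices beyond the size of [p] are empty sums, so [j] is in range. *)
  have lt_j : (j < (msize p).+1)%N.
    rewrite ltnNge; apply: contra sj0 => lt_pj; rewrite mmap_slice big_seq_cond.
    rewrite big1 // => m /andP[mp /eqP mi].
    have := msize_mdeg_lt mp; rewrite mdegE (bigD1 i) //= mi; lia.
  by exists (Ordinal lt_j); rewrite cE.
have [i [m [mp mi]]] : exists i m, m \in msupp p /\ (0 < m i)%N.
  apply: contrapT => no; have pC : p = (p@_0)%:MP.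
    apply/msize1_polyC; rewrite msizeE; apply/bigmax_leqP_seq => m mp _.
    rewrite ltnS leqn0 mdeg_eq0; apply/eqP/mnmP => i; rewrite mnm0E.
    by apply/eqP; rewrite -leqn0 leqNgt; apply/negP => ?; apply: no; exists i, m.
  move: yp0; rewrite pC mmapC => /eqP; rewrite fmorph_eq0 => /eqP pz.
  by move: p0; rewrite pC pz mpolyC0 eqxx.
have := slice_neq0 i mp; rewrite (IHk (slice p i (m i))) ?eqxx //.
by apply: leq_trans le_pk; apply: msize_slice.
Qed.

(** * Matrices of bounded rank and coordinate planes *)

(** The variety of [a] by [b] matrices of rank [r] has dimension
[r * (a + b - r)]: keep [r] independent rows, and for each other row its [r]
coefficients in terms of them.  The rows that are kept cost no coefficients,
which is where the term [- r] comes from. *)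
Lemma rank_factorization_generators (K : fieldType) a b (B : 'M[K]_(a, b)) :
  exists s : seq K,
    size s = (\rank B * (a + b - \rank B))%N /\
    forall S : subringClosed K, {subset s <= S} -> forall i j, B i j \in S.
Proof.
pose f := maxrankfun B; pose C := rowsub f B; pose D := B *m pinvmx C.
have BE : B = D *m C by rewrite mulmxKpV // eq_maxrowsub.
pose I := ~: f @: 'I_(\rank B).
exists ([seq C k j | k <- enum 'I_(\rank B), j <- enum 'I_b]
        ++ [seq D i k | i <- enum I, k <- enum 'I_(\rank B)]); split.
  have cI : (#|I| = a - \rank B)%N.
    by rewrite cardsCs finset.setCK card_imset ?card_ord //; apply: maxrankfun_inj.
  rewrite size_cat !size_allpairs -!cardE !card_ord cI.
  have := rank_leq_row B; nia.
move=> S sS i j.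
have CS k : C k j \in S.
  by apply: sS; rewrite mem_cat allpairs_f ?mem_enum.
have [/imsetP[k _ ->]|iI] := boolP (i \in f @: 'I_(\rank B)).
  by have := CS k; rewrite mxE.
rewrite BE mxE rpred_sum // => k _; apply: rpredM => //.
by apply: sS; rewrite mem_cat orbC allpairs_f ?mem_enum ?inE.
Qed.

Section CoordinatePlanes.
Variables (R : realType) (m : nat).
Implicit Types (I J : {set 'I_m}) (V : {vspace 'rV[R]_m}).

Definition coord_span I : {vspace 'rV[R]_m} :=
  span [seq delta_mx ord0 i : 'rV[R]_m | i <- enum I].

Lemma delta_coord_span I i : i \in I -> delta_mx ord0 i \in coord_span I.
Proof. by move=> iI; apply/memv_span/map_f; rewrite mem_enum. Qed.

(** The spans of [I] and of its complement have dimensions at most their numbers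
of generators, and together they fill the whole space; so neither bound is
strict. *)
Lemma dim_coord_span I : \dim (coord_span I) = #|I|.
Proof.
have ub J : (\dim (coord_span J) <= #|J|)%N.
  by apply: leq_trans (dim_span _) _; rewrite size_map -cardE.
apply/eqP; rewrite eqn_leq ub /= -(leq_add2r #|~: I|) cardsC card_ord.
apply: leq_trans (leq_add (leqnn _) (ub (~: I))).
apply: leq_trans (dimv_add_leqif _ _).
apply: (@leq_trans (\dim {: 'rV[R]_m})); first by rewrite dimvf /dim /= mul1n.
apply/dimvS/subvP => v _; rewrite [v]row_sum_delta memv_suml // => i _.
apply: memvZ; have [iI|iI] := boolP (i \in I).
  by apply: subvP (addvSl _ _) _ _; apply: delta_coord_span.
by apply: subvP (addvSr _ _) _ _; apply: delta_coord_span; rewrite inE.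
Qed.

Lemma coord_span_ker I b (f : 'I_b -> 'I_m) :
    (forall j, f j \notin I) ->
  (coord_span I <= lker (linfun (colsub f : 'rV[R]_m -> 'rV[R]_b)))%VS.
Proof.
move=> fI; apply/span_subvP => _ /mapP[i + ->].
rewrite mem_enum memv_ker lfunE => iI; apply/eqP/rowP => j.
by rewrite !mxE eqxx /=; case: eqP => // fij; have := fI j; rewrite fij iI.
Qed.

Lemma coord_span_eq0 I v i : v \in coord_span I -> i \notin I -> v 0 i = 0.
Proof.
move=> vI iI.
have /(_ (fun _ : 'I_1 => iI))/subvP/(_ v vI) := @coord_span_ker I 1 (fun=> i).
by rewrite memv_ker lfunE => /eqP/rowP/(_ 0); rewrite !mxE.
Qed.

(** The rows of [B] lie in the image of [V] under the projection to the
coordinates selected by [f], and the span of [I] is in its kernel; the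
rank-nullity formula on [V] gives the bound. *)
Lemma rank_projection_le V I a b (B : 'M[R]_(a, b)) (x : 'I_a -> 'rV[R]_m)
    (f : 'I_b -> 'I_m) :
    (coord_span I <= V)%VS -> (forall j, f j \notin I) ->
    (forall i, x i \in V) -> (forall i j, B i j = x i 0 (f j)) ->
  (\rank B <= \dim V - #|I|)%N.
Proof.
move=> IV fI xV BE.
pose g : 'Hom('rV[R]_m, 'rV[R]_b) := linfun (colsub f).
have gE v : g v = colsub f v by rewrite lfunE.
have rk_img : (\rank B <= \dim (g @: V))%N.
  pose X := vbasis (g @: V).
  pose E := \matrix_(k < \dim (g @: V)) X`_k.
  apply: leq_trans (rank_leq_row E); apply/mxrankS/row_subP => i.
  have -> : row i B = g (x i) by rewrite gE; apply/rowP => j; rewrite !mxE BE.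
  rewrite (coord_vbasis (memv_img g (xV i))); apply: summx_sub => k _.
  by apply: scalemx_sub; rewrite -[_`_k](rowK (fun k : 'I__ => X`_k)) row_sub.
apply: leq_trans rk_img _; rewrite -(limg_ker_dim g V) -dim_coord_span.
have /dimvS : (coord_span I <= V :&: lker g)%VS; last first.
  by move=> leI; rewrite -addnBAC // leq_addl.
by rewrite subv_cap IV coord_span_ker.
Qed.
End CoordinatePlanes.

Lemma direction_unique (R : realType) m (P : set 'rV[R]_m) V W :
  is_translate P V -> is_translate P W -> V = W.
Proof.
move=> [p ->] [r PE]; apply/vspaceP => v.
have E u : (u - p \in V) = (u - r \in W).
  by have /= /propeqP := congr1 (fun X : set _ => X u) PE => -[h1 h2]; apply/idP/idP.
have pW : p - r \in W by rewrite -E subrr mem0v.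
have := E (v + p); rewrite addrK => ->.
by rewrite -addrA rpredDr.
Qed.

(** * Solving for a pivot and counting the parameters *)

(** In an affine combination with [c p != 0] the pivot point is recovered from
everything else, and [c p] itself is one minus the other coefficients. *)
Lemma pivot_coordinates (K : fieldType) (S : divringClosed K) n m
    (A : 'I_n -> 'rV[K]_m) (c : 'I_n -> K) (x : 'rV[K]_m) (p : 'I_n) :
    \sum_j c j = 1 -> x = \sum_j c j *: A j -> c p != 0 ->
    (forall j, j != p -> c j \in S) ->
    (forall j k, j != p -> A j 0 k \in S) -> (forall k, x 0 k \in S) ->
  forall j k, A j 0 k \in S.
Proof.
move=> c1 xE cp cS AS xS j k; have [->{j}|] := eqVneq j p; last exact: AS.
have cpS : c p \in S.
  move: c1; rewrite (bigD1 p) //= => /(canRL (addrK _)) ->.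
  by rewrite rpredB ?rpred1 // rpred_sum.
have -> : A p 0 k = (x 0 k - \sum_(j | j != p) c j * A j 0 k) / c p.
  rewrite xE summxE (bigD1 p) //= mxE; under eq_bigr do rewrite mxE.
  by rewrite addrK mulrC mulKf.
apply: rpred_div => //; rewrite rpredB // rpred_sum // => j jp.
by rewrite rpredM ?cS ?AS.
Qed.

(** Here [s] is the sum of the [n i], [q.+1] the number of families and [r] the
rank of the matrix of differences.  The generators on the left are, in order:
non-pivot points, non-pivot coefficients, one intersection point, the free
directions of the differences, and the matrix of rank [r].  The quantity
[r * (q + (T - t) - r)] increases with [r] up to [minn q (T - t)], so the worst
case is [r = d - t] under (a) and [r = q] under (b). *)
Lemma parameter_count (m q t d T s r : nat) :
    (t <= d)%N -> (d <= T)%N -> (T <= m)%N ->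
    (r <= d - t)%N -> (r <= q)%N ->
    (d%:Z - t%:Z + 1 <= q.+1%:Z /\
       s%:Z + 1 <= (m%:Z - d%:Z) * (q.+1%:Z - 1)
                   - (T%:Z - d%:Z) * (d%:Z - t%:Z))
    \/ (q.+1%:Z <= d%:Z - t%:Z + 1 /\ s%:Z + 1 <= (m%:Z - T%:Z) * (q.+1%:Z - 1)) ->
  (s * m + (s + (m + (q * t + r * (q + (T - t) - r)))) < (s + q.+1) * m)%N.
Proof.
(* Writing each variable as a lower bound plus an increment removes the
   truncated subtractions and turns the rank bounds into positivity. *)
move=> /subnKC <-; move: (d - t)%N => e {d}.
move=> /subnKC <-; move: (T - _)%N => f {T}.
move=> /subnKC <-; move: (m - _)%N => g {m}.
rewrite addKn => /subnKC <-; move: (e - r)%N => e' {e}.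
move=> /subnKC <-; move: (q - r)%N => q' {q} hab.
have -> : (r + q' + (t + (r + e') + f - t) - r = r + q' + e' + f)%N by lia.
by case: hab => -[h1 h2]; nia.
Qed.

Lemma card_tagged_sum (I : finType) (E : I -> finType) :
  #|{: {i : I & E i}}| = (\sum_i #|E i|)%N.
Proof. by rewrite card_tagged sumnE big_map big_enum. Qed.

Lemma size_coordinates (R : realType) m q (n : 'I_q -> nat)
    (A : forall i : 'I_q, 'I_(n i).+1 -> 'rV[R]_m) :
  size (coordinates A) = ((\sum_i n i + q) * m)%N.
Proof.
rewrite size_image card_tagged_sum.
under eq_bigr do rewrite card_prod !card_ord.
rewrite -big_distrl; congr (_ * _)%N => /=.
by under eq_bigr do rewrite -addn1; rewrite big_split /= sum1_card card_ord.
Qed.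

Theorem theorem1p1 (R : realType) (m q : nat) (n : 'I_q -> nat)
    (A : forall i : 'I_q, 'I_(n i).+1 -> 'rV[R]_m)
    (t d T : nat) (Pd : set 'rV[R]_m) (Pt PT : {vspace 'rV[R]_m})
    (hm : (1 <= m)%N) (hq : (1 <= q)%N)
    (hdistinct : uniq (coordinates A))
    (hindep : alg_independent (coordinates A))
    (htd : (t <= d)%N) (hdT : (d <= T)%N) (hTm : (T <= m)%N)
    (hPd : is_plane d Pd)
    (hPt : is_coord_plane t Pt) (hPT : is_coord_plane T PT)
    (hpar : parallel_to Pd Pt PT)
    (hab :
      (d%:Z - t%:Z + 1 <= q%:Z /\
       \sum_(i < q) (n i)%:Z + 1 <=
         (m%:Z - d%:Z) * (q%:Z - 1) - (T%:Z - d%:Z) * (d%:Z - t%:Z))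
      \/
      (q%:Z <= d%:Z - t%:Z + 1 /\
       \sum_(i < q) (n i)%:Z + 1 <= (m%:Z - T%:Z) * (q%:Z - 1))) :
  exists i : 'I_q, Pd `&` affine_span (A i) = set0.
Proof.
apply: contrapT => /forallNP meets.
have meet i : {x & {c : 'I_(n i).+1 -> R |
    [/\ Pd x, \sum_j c j = 1 & x = \sum_j c j *: A i j]}}.
  have : Pd `&` affine_span (A i) !=set0 by apply/set0P/eqP/meets.
  move=> /cid[x [Px /cid[c [c1 xE]]]].
  by exists x, c.
pose x i := projT1 (meet i); pose c i := sval (projT2 (meet i)).
have cP i : [/\ Pd (x i), \sum_j c i j = 1 & x i = \sum_j c i j *: A i j].
  exact: svalP (projT2 (meet i)).
have pivot i : {p | c i p != 0}.
  apply: cid; apply: contrapT => /forallNP c0; have [_ /eqP + _] := cP i.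
  rewrite big1 ?(eq_sym 0) ?oner_eq0 // => j _.
  by apply/eqP; apply: contrapT => /negP /c0.
pose p i := sval (pivot i).
have [V0 [dV0 trV0]] := hPd; have [V [trV /andP[PtV VPT]]] := hpar.
have {V0 dV0 trV0} dV : \dim V = d by rewrite (direction_unique trV trV0).
have [I [cI PtE]] := hPt; have [J [cJ PTE]] := hPT.
rewrite -/(coord_span R I) in PtE; rewrite -/(coord_span R J) in PTE.
rewrite {}PtE in PtV; rewrite {}PTE in VPT.
have IJ : I \subset J.
  apply/fintype.subsetP => i iI; apply: contraT => iJ.
  have := coord_span_eq0 (subvP (subv_trans PtV VPT) _ (delta_coord_span R iI)) iJ.
  by rewrite mxE !eqxx => /eqP; rewrite oner_eq0.
case: q hq => // q _ in n A hdistinct hindep hab meets meet x c cP pivot p *.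
(* A fixed base point [x ord0]: only differences from it lie in [V]. *)
pose y i := x (lift ord0 i) - x ord0.
have yV i : y i \in V.
  have [o PdE] := trV; have Px j : x j - o \in V.
    by have [+ _ _] := cP j; rewrite PdE.
  by rewrite /y -[x (lift _ _)](subrK o) -addrA -[o - _]opprB rpredB.
pose b := #|J :\: I|; have bE : b = (T - t)%N.
  by rewrite /b cardsD (finset.setIidPr IJ) cI cJ.
pose f (k : 'I_b) : 'I_m := enum_val k.
have fI k : f k \notin I by have := enum_valP k; rewrite inE => /andP[].
pose B := \matrix_(i < q, k < b) y i 0 (f k).
have rkB : (\rank B <= d - t)%N.
  by rewrite -dV -cI; apply: rank_projection_le PtV fI yV _ => i k; rewrite mxE.
have [sB [size_sB genB]] := rank_factorization_generators B.
pose sA := [seq A (tag u) (lift (p (tag u)) (tagged u).1) 0 (tagged u).2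
             | u : {i : 'I_q.+1 & ('I_(n i) * 'I_m)%type}].
pose sc := [seq c (tag u) (lift (p (tag u)) (tagged u))
             | u : {i : 'I_q.+1 & 'I_(n i)}].
pose sx := [seq x ord0 0 k | k : 'I_m].
pose sI := [seq y i 0 k | i <- enum 'I_q, k <- enum I].
pose w := sA ++ (sc ++ (sx ++ (sI ++ sB))).
pose s := (\sum_i n i)%N.
have size_w : size w = (s * m + (s + (m + (q * t
                          + \rank B * (q + (T - t) - \rank B)))))%N.
  rewrite -bE -[in RHS]cI !size_cat !size_image size_allpairs -!cardE !card_ord.
  rewrite size_sB.
  rewrite !card_tagged_sum; under eq_bigr do rewrite card_prod !card_ord.
  rewrite -big_distrl; congr (_ + (_ + _))%N.
  by apply: eq_bigr => i _; rewrite card_ord.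
pose iota : {rmorphism rat -> R} := @ratr R.
pose S := ratfun_values iota (tnth (in_tuple w)).
have wS : {subset w <= S}.
  by move=> v /(tnthP (in_tuple w))[k ->]; apply: ratfun_values_gen.
have yS i k : y i 0 k \in S.
  have [kI|kI] := boolP (k \in I).
    apply: wS; rewrite !mem_cat.
    by rewrite [_ \in sI](allpairs_f (fun i k => y i 0 k)) ?mem_enum ?orbT.
  have [kJ|kJ] := boolP (k \in J); last first.
    by rewrite (coord_span_eq0 (subvP VPT _ (yV i)) kJ) rpred0.
  have kJI : k \in J :\: I by rewrite inE kI.
  have -> : y i 0 k = B i (enum_rank_in kJI k).
    by rewrite [RHS]mxE /f enum_rankK_in.
  by apply: genB => v vB; apply: wS; rewrite !mem_cat vB !orbT.
have xS i k : x i 0 k \in S.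
  have x0S : x ord0 0 k \in S.
    by apply: wS; rewrite !mem_cat [_ \in sx](codom_f (fun k => x ord0 0 k)) ?orbT.
  case: (unliftP ord0 i) => [j ->|-> //].
  by rewrite -[x _](subrK (x ord0)) mxE rpredD // yS.
have AS i j k : A i j 0 k \in S.
  have [_ c1 xE] := cP i.
  apply: pivot_coordinates c1 xE (svalP (pivot i)) _ _ (xS i) _ _.
  - move=> {}j; rewrite eq_sym => /unlift_some[l -> _].
    apply: wS; rewrite !mem_cat.
    by rewrite [_ \in sc](codom_f _ (Tagged (fun i => 'I_(n i)) l)) ?orbT.
  - move=> {}j {}k; rewrite eq_sym => /unlift_some[l -> _].
    apply: wS; rewrite !mem_cat.
    by rewrite [_ \in sA](codom_f _ (Tagged (fun i => ('I_(n i) * 'I_m)%type) (l, k))).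
have [||Q Q0 QA] := @algebraic_relation _ _ iota _ _ (tnth (in_tuple w))
                       (tnth (in_tuple (coordinates A))).
- rewrite size_w size_coordinates; apply: parameter_count rkB _ _ => //.
    exact: rank_leq_row.
  by rewrite (big_morph Posz PoszD erefl).
- move=> k; have /fintype.imageP[u _ ->] := mem_tnth k (in_tuple (coordinates A)).
  exact: AS.
by have := alg_independent_relation hdistinct hindep QA; apply/eqP.
Qed.
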